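(* $\mathsf{BIM}\vdash(\ast)\rightarrow\mathbf{LPO}$, where $(\ast)$ is the scheme: for every subset $R$ of $\mathbb N$, either $\exists\zeta\in[\omega]^\omega\forall s\in[\omega]^2[\zeta\circ s\in R]$ or $\exists\zeta\in[\omega]^\omega\forall s\in[\omega]^2[\zeta\circ s\notin R]$; and $\mathbf{LPO}$ is: for every $\alpha$, $\exists n[\alpha(n)\ne0]\vee\forall n[\alpha(n)=0]$.
   Context: $\mathsf{BIM}$ is the two-sorted formal theory with intuitionistic logic of natural numbers and functions $\mathbb N\to\mathbb N$, with extensionality, primitive recursive constants, closure of functions under composition, primitive recursion and unbounded search, and full induction. Finite sequences are coded by naturals. $[\omega]^\omega$ is the set of strictly increasing $\zeta:\mathbb N\to\mathbb N$, $[\omega]^k$ the set of codes of strictly increasing sequences of length $k$; for $s\in[\omega]^k$, $\zeta\circ s$ is the code of $\langle\zeta(s(0)),\dots,\zeta(s(k-1))\rangle$. *)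

(* Defs.v *)
From Stdlib Require Import List.
Import ListNotations.

(** * The language of BIM

    Two sorts: natural numbers (sort 0) and functions from N to N (sort 1).
    Variables of each sort are de Bruijn indices, counted separately: the
    quantifiers [all0], [ex0] bind number variables, [all1], [ex1] bind function
    variables. *)

(** Constants for the primitive recursive functions.  As usual in BIM, a function
    of several arguments is a unary function of a code of its arguments, where
    (m,n) is coded by J(m,n) and (m,n,p) by J(J(m,n),p).  [cComp f g] is
    n |-> f(g(n)), [cPair f g] is n |-> J(f(n),g(n)), and h := [cRec f g] is given
    by h(m,0) = f(m), h(m,S(n)) = g(m,n,h(m,n)); the defining equations are
    among the axioms [BIM] below. *)
Inductive fconst : Type :=
| cId | cZero | cSuc | cK | cL
| cComp (f g : fconst)
| cPair (f g : fconst)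
| cRec (f g : fconst).

Inductive fterm : Type :=
| fvar (i : nat)
| fcst (c : fconst).

(** [tpair] is the pairing symbol J. *)
Inductive term : Type :=
| tvar (i : nat)
| tzero
| tpair (t u : term)
| tapp (F : fterm) (t : term).

Inductive form : Type :=
| bot
| eq0 (t u : term)
| eq1 (F G : fterm)
| and (A B : form)
| or (A B : form)
| imp (A B : form)
| all0 (A : form)
| ex0 (A : form)
| all1 (A : form)
| ex1 (A : form).

Definition neg (A : form) : form := imp A bot.
Definition iff (A B : form) : form := and (imp A B) (imp B A).

(** * Substitution *)

Definition subst_fterm (tau : nat -> fterm) (F : fterm) : fterm :=
  match F with fvar i => tau i | fcst c => fcst c end.

Fixpoint subst_term (sigma : nat -> term) (tau : nat -> fterm) (t : term) : term :=
  match t with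
  | tvar i => sigma i
  | tzero => tzero
  | tpair t u => tpair (subst_term sigma tau t) (subst_term sigma tau u)
  | tapp F t => tapp (subst_fterm tau F) (subst_term sigma tau t)
  end.

Definition wk0 (i : nat) : term := tvar (S i).
Definition wk1 (i : nat) : fterm := fvar (S i).

Definition scons {X : Type} (x : X) (s : nat -> X) (i : nat) : X :=
  match i with 0 => x | S i => s i end.

Fixpoint subst (sigma : nat -> term) (tau : nat -> fterm) (A : form) : form :=
  match A with
  | bot => bot
  | eq0 t u => eq0 (subst_term sigma tau t) (subst_term sigma tau u)
  | eq1 F G => eq1 (subst_fterm tau F) (subst_fterm tau G)
  | and A B => and (subst sigma tau A) (subst sigma tau B)
  | or A B => or (subst sigma tau A) (subst sigma tau B)
  | imp A B => imp (subst sigma tau A) (subst sigma tau B)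
  | all0 A =>
      all0 (subst (scons (tvar 0) (fun i => subst_term wk0 fvar (sigma i))) tau A)
  | ex0 A =>
      ex0 (subst (scons (tvar 0) (fun i => subst_term wk0 fvar (sigma i))) tau A)
  | all1 A =>
      all1 (subst (fun i => subst_term tvar wk1 (sigma i))
                  (scons (fvar 0) (fun i => subst_fterm wk1 (tau i))) A)
  | ex1 A =>
      ex1 (subst (fun i => subst_term tvar wk1 (sigma i))
                 (scons (fvar 0) (fun i => subst_fterm wk1 (tau i))) A)
  end.

Definition lift0 (A : form) : form := subst wk0 fvar A.
Definition lift1 (A : form) : form := subst tvar wk1 A.
Definition inst0 (A : form) (t : term) : form := subst (scons t tvar) fvar A.
Definition inst1 (A : form) (F : fterm) : form := subst tvar (scons F fvar) A.

(** * Two-sorted intuitionistic logic with equality *)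

Inductive nd : list form -> form -> Prop :=
| nd_hyp Gamma A : In A Gamma -> nd Gamma A
| nd_botE Gamma A : nd Gamma bot -> nd Gamma A
| nd_andI Gamma A B : nd Gamma A -> nd Gamma B -> nd Gamma (and A B)
| nd_andE1 Gamma A B : nd Gamma (and A B) -> nd Gamma A
| nd_andE2 Gamma A B : nd Gamma (and A B) -> nd Gamma B
| nd_orI1 Gamma A B : nd Gamma A -> nd Gamma (or A B)
| nd_orI2 Gamma A B : nd Gamma B -> nd Gamma (or A B)
| nd_orE Gamma A B C :
    nd Gamma (or A B) -> nd (A :: Gamma) C -> nd (B :: Gamma) C -> nd Gamma C
| nd_impI Gamma A B : nd (A :: Gamma) B -> nd Gamma (imp A B)
| nd_impE Gamma A B : nd Gamma (imp A B) -> nd Gamma A -> nd Gamma B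
| nd_all0I Gamma A : nd (map lift0 Gamma) A -> nd Gamma (all0 A)
| nd_all0E Gamma A t : nd Gamma (all0 A) -> nd Gamma (inst0 A t)
| nd_ex0I Gamma A t : nd Gamma (inst0 A t) -> nd Gamma (ex0 A)
| nd_ex0E Gamma A B :
    nd Gamma (ex0 A) -> nd (A :: map lift0 Gamma) (lift0 B) -> nd Gamma B
| nd_all1I Gamma A : nd (map lift1 Gamma) A -> nd Gamma (all1 A)
| nd_all1E Gamma A F : nd Gamma (all1 A) -> nd Gamma (inst1 A F)
| nd_ex1I Gamma A F : nd Gamma (inst1 A F) -> nd Gamma (ex1 A)
| nd_ex1E Gamma A B :
    nd Gamma (ex1 A) -> nd (A :: map lift1 Gamma) (lift1 B) -> nd Gamma B
| nd_eq0I Gamma t : nd Gamma (eq0 t t)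
| nd_eq0E Gamma A t u : nd Gamma (eq0 t u) -> nd Gamma (inst0 A t) -> nd Gamma (inst0 A u)
| nd_eq1I Gamma F : nd Gamma (eq1 F F)
| nd_eq1E Gamma A F G : nd Gamma (eq1 F G) -> nd Gamma (inst1 A F) -> nd Gamma (inst1 A G).

Definition proves (T : form -> Prop) (A : form) : Prop :=
  exists Gamma : list form, (forall B, In B Gamma -> T B) /\ nd Gamma A.

(** T |- (scheme) -> A: a scheme is the set of its instances, and T proves that
    some finitely many of them together imply A. *)
Definition proves_scheme_imp (T scheme : form -> Prop) (A : form) : Prop :=
  exists Delta : list form,
    (forall B, In B Delta -> scheme B) /\ proves T (fold_right imp A Delta).

(** * Universal closure *)

(** [bd0] and [bd1] are strict upper bounds on the free number variables,
    respectively function variables. *)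
Definition bd1_fterm (F : fterm) : nat :=
  match F with fvar i => S i | fcst _ => 0 end.

Fixpoint bd0_term (t : term) : nat :=
  match t with
  | tvar i => S i
  | tzero => 0
  | tpair t u => Nat.max (bd0_term t) (bd0_term u)
  | tapp _ t => bd0_term t
  end.

Fixpoint bd1_term (t : term) : nat :=
  match t with
  | tvar _ => 0
  | tzero => 0
  | tpair t u => Nat.max (bd1_term t) (bd1_term u)
  | tapp F t => Nat.max (bd1_fterm F) (bd1_term t)
  end.

Fixpoint bd0 (A : form) : nat :=
  match A with
  | bot => 0
  | eq0 t u => Nat.max (bd0_term t) (bd0_term u)
  | eq1 _ _ => 0
  | and A B | or A B | imp A B => Nat.max (bd0 A) (bd0 B)
  | all0 A | ex0 A => Nat.pred (bd0 A)
  | all1 A | ex1 A => bd0 A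
  end.

Fixpoint bd1 (A : form) : nat :=
  match A with
  | bot => 0
  | eq0 t u => Nat.max (bd1_term t) (bd1_term u)
  | eq1 F G => Nat.max (bd1_fterm F) (bd1_fterm G)
  | and A B | or A B | imp A B => Nat.max (bd1 A) (bd1 B)
  | all0 A | ex0 A => bd1 A
  | all1 A | ex1 A => Nat.pred (bd1 A)
  end.

Definition closure (A : form) : form :=
  Nat.iter (bd1 A) all1 (Nat.iter (bd0 A) all0 A).

(** * Abbreviations *)

Definition capp (c : fconst) (t : term) : term := tapp (fcst c) t.
Definition capp2 (c : fconst) (t u : term) : term := capp c (tpair t u).
Definition suc (t : term) : term := capp cSuc t.
Definition num (k : nat) : term := Nat.iter k suc tzero.

Definition cPlus : fconst := cRec cId (cComp cSuc cL).

Definition cPred : fconst := cComp (cRec cZero (cComp cL cK)) (cPair cZero cId).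

(** (m,n) |-> m - n, truncated *)
Definition cMonus : fconst := cRec cId (cComp cPred cL).

(** t < u, as: exists p, t + S(p) = u *)
Definition lt (t u : term) : form :=
  ex0 (eq0 (capp2 cPlus (subst_term wk0 fvar t) (suc (tvar 0)))
           (subst_term wk0 fvar u)).

(** * Axioms of BIM *)

Definition app2 (F : fterm) (t u : term) : term := tapp F (tpair t u).
Definition app3 (F : fterm) (t u v : term) : term := app2 F (tpair t u) v.

Definition ax_extensionality : form :=
  all1 (all1 (iff (eq1 (fvar 1) (fvar 0))
                  (all0 (eq0 (tapp (fvar 1) (tvar 0)) (tapp (fvar 0) (tvar 0)))))).

Definition ax_comp : form :=
  all1 (all1 (ex1 (all0
    (eq0 (tapp (fvar 0) (tvar 0)) (tapp (fvar 2) (tapp (fvar 1) (tvar 0))))))).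

(** forall alpha beta gamma, exists delta, forall n, delta(n) = gamma(alpha(n),beta(n)) *)
Definition ax_comp2 : form :=
  all1 (all1 (all1 (ex1 (all0
    (eq0 (tapp (fvar 0) (tvar 0))
         (app2 (fvar 1) (tapp (fvar 3) (tvar 0)) (tapp (fvar 2) (tvar 0)))))))).

(** forall alpha beta, exists gamma, forall m n,
    gamma(m,0) = alpha(m) /\ gamma(m,S(n)) = beta(m,n,gamma(m,n)) *)
Definition ax_primrec : form :=
  all1 (all1 (ex1 (all0 (all0
    (and (eq0 (app2 (fvar 0) (tvar 1) tzero) (tapp (fvar 2) (tvar 1)))
         (eq0 (app2 (fvar 0) (tvar 1) (suc (tvar 0)))
              (app3 (fvar 1) (tvar 1) (tvar 0) (app2 (fvar 0) (tvar 1) (tvar 0))))))))).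

(** forall alpha, (forall m, exists n, alpha(m,n) = 0) -> exists gamma, forall m,
    alpha(m,gamma(m)) = 0 /\ forall n < gamma(m), alpha(m,n) <> 0 *)
Definition ax_search : form :=
  all1 (imp (all0 (ex0 (eq0 (app2 (fvar 0) (tvar 1) (tvar 0)) tzero)))
            (ex1 (all0
              (and (eq0 (app2 (fvar 1) (tvar 0) (tapp (fvar 0) (tvar 0))) tzero)
                   (all0 (imp (lt (tvar 0) (tapp (fvar 0) (tvar 1)))
                              (neg (eq0 (app2 (fvar 1) (tvar 1) (tvar 0)) tzero)))))))).

(** The induction axiom for the formula A(n), where n is number variable 0 and the
    other free variables are parameters. *)
Definition ax_induction (A : form) : form :=
  closure (imp (and (inst0 A tzero)
                    (all0 (imp A (subst (scons (suc (tvar 0)) wk0) fvar A))))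
               (all0 A)).

Inductive BIM : form -> Prop :=
| BIM_extensionality : BIM ax_extensionality
| BIM_Id : BIM (all0 (eq0 (capp cId (tvar 0)) (tvar 0)))
| BIM_Zero : BIM (all0 (eq0 (capp cZero (tvar 0)) tzero))
| BIM_Suc_neq0 : BIM (all0 (neg (eq0 (suc (tvar 0)) tzero)))
| BIM_Suc_inj :
    BIM (all0 (all0 (imp (eq0 (suc (tvar 1)) (suc (tvar 0))) (eq0 (tvar 1) (tvar 0)))))
| BIM_K : BIM (all0 (all0 (eq0 (capp cK (tpair (tvar 1) (tvar 0))) (tvar 1))))
| BIM_L : BIM (all0 (all0 (eq0 (capp cL (tpair (tvar 1) (tvar 0))) (tvar 0))))
| BIM_J : BIM (all0 (eq0 (tpair (capp cK (tvar 0)) (capp cL (tvar 0))) (tvar 0)))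
| BIM_Comp f g :
    BIM (all0 (eq0 (capp (cComp f g) (tvar 0)) (capp f (capp g (tvar 0)))))
| BIM_Pair f g :
    BIM (all0 (eq0 (capp (cPair f g) (tvar 0))
                   (tpair (capp f (tvar 0)) (capp g (tvar 0)))))
| BIM_Rec0 f g :
    BIM (all0 (eq0 (capp2 (cRec f g) (tvar 0) tzero) (capp f (tvar 0))))
| BIM_RecS f g :
    BIM (all0 (all0 (eq0 (capp2 (cRec f g) (tvar 1) (suc (tvar 0)))
                         (app3 (fcst g) (tvar 1) (tvar 0)
                               (capp2 (cRec f g) (tvar 1) (tvar 0))))))
| BIM_comp : BIM ax_comp
| BIM_comp2 : BIM ax_comp2
| BIM_primrec : BIM ax_primrec
| BIM_search : BIM ax_search
| BIM_induction A : BIM (ax_induction A).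

(** * Coding of finite sequences

    <> is coded by 0, and <x_0,...,x_k> by S(J(k, J(x_0, J(x_1, ... x_k)))); thus
    every natural number codes exactly one finite sequence. *)

Fixpoint tuple (x : term) (l : list term) : term :=
  match l with [] => x | y :: l => tpair x (tuple y l) end.

Definition code (l : list term) : term :=
  match l with
  | [] => tzero
  | x :: l => suc (tpair (num (length l)) (tuple x l))
  end.

(** length(0) = 0, length(S(n)) = S(K(n)) *)
Definition cLength : fconst :=
  cComp (cRec cZero (cComp cSuc (cComp cK (cComp cL cK)))) (cPair cZero cId).

(** (t,i) |-> L(L(...L(t))), i times *)
Definition cIterL : fconst := cRec cId (cComp cL cL).

(** ((a,b),c) |-> a if c = 0, b otherwise *)
Definition cIf : fconst := cRec cK (cComp cL (cComp cK cK)).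

(** s(i).  For s = S(J(k,t)) and i <= k this is L^i(t) if k - i = 0, and
    K(L^i(t)) otherwise. *)
Definition cEntry : fconst :=
  let k := cComp cK (cComp cPred cK) in
  let t := cComp cL (cComp cPred cK) in
  let ti := cComp cIterL (cPair t cL) in
  cComp cIf (cPair (cPair ti (cComp cK ti)) (cComp cMonus (cPair k cL))).

(** F in [omega]^omega *)
Definition incr_fun (F : fterm) : form :=
  all0 (lt (tapp F (tvar 0)) (tapp F (suc (tvar 0)))).

(** s in [omega]^k *)
Definition incr_seq (k : nat) (s : term) : form :=
  let s' := subst_term wk0 fvar s in
  and (eq0 (capp cLength s) (num k))
      (all0 (imp (lt (suc (tvar 0)) (num k))
                 (lt (capp2 cEntry s' (tvar 0)) (capp2 cEntry s' (suc (tvar 0)))))).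

(** zeta o s, for s in [omega]^k *)
Definition comp_seq (k : nat) (F : fterm) (s : term) : term :=
  code (map (fun i => tapp F (capp2 cEntry s (num i))) (seq 0 k)).

(** * The scheme and LPO *)

(** A subset R of N is given by a formula R(x), where x is number variable 0 and
    the other free variables are parameters.  [homogeneous k R] says:
    exists zeta in [omega]^omega, forall s in [omega]^k, zeta o s in R.
    The binders of zeta and s shift the parameters of R. *)
Definition homogeneous (k : nat) (R : form) : form :=
  ex1 (and (incr_fun (fvar 0))
           (all0 (imp (incr_seq k (tvar 0))
                      (subst (scons (comp_seq k (fvar 0) (tvar 0)) wk0) wk1 R)))).

Inductive Star : form -> Prop :=
| Star_instance R :
    Star (closure (or (homogeneous 2 R) (homogeneous 2 (neg R)))).

Definition LPO : form :=
  all1 (or (ex0 (neg (eq0 (tapp (fvar 0) (tvar 0)) tzero)))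
           (all0 (eq0 (tapp (fvar 0) (tvar 0)) tzero))).

(* Main.v *)
(** The set [R] in the scheme may be given by a formula in which the sequence
    does not occur.  For R := "exists n, alpha(n) <> 0" the scheme yields R or not R,
    because [omega]^2 is inhabited, for instance by <0,1>.  In the second case
    alpha(n) = 0 for all n, because equality to 0 is decidable. *)

From Stdlib Require Import List Setoid Morphisms.
Require Import Defs.
Import ListNotations.

(** * Derivability from BIM *)

Lemma nd_weaken Gamma A : nd Gamma A -> forall Delta, incl Gamma Delta -> nd Delta A.
Proof.
  assert (Hcons : forall A (G D : list form), incl G D -> incl (A :: G) (A :: D))
    by (intros B G D H; apply incl_cons; [now left | now apply incl_tl]).
  induction 1; intros Delta HD; solve [econstructor; eauto using incl_map].
Qed.

(** The axioms used are closed, so that they survive the shifts of the context in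
    the quantifier rules. *)
Definition axiom (B : form) : Prop := BIM B /\ lift0 B = B /\ lift1 B = B.

(** The list of axioms is existential, so that different premises of a rule may use different
    axioms. It stands at the end, so that discharging the head of [Gamma] is still a rule of
    [nd]. *)
Definition der (Gamma : list form) (A : form) : Prop :=
  exists Delta, Forall axiom Delta /\ nd (Gamma ++ Delta) A.

Lemma der_proves A : der [] A -> proves BIM A.
Proof.
  intros (D & HD & H). exists D. split; [|exact H].
  intros B HB. rewrite Forall_forall in HD. apply HD, HB.
Qed.

Lemma der_weaken Gamma Delta A : der Gamma A -> incl Gamma Delta -> der Delta A.
Proof.
  intros (D & HD & H) HG. exists D. split; [exact HD|].
  apply nd_weaken with (1 := H). now apply incl_app_app.
Qed.

Lemma der_axiom Gamma A : axiom A -> der Gamma A.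
Proof.
  intros HA. exists [A]. split; [now constructor|].
  apply nd_hyp, in_or_app. right. now left.
Qed.

Lemma der_nd1 Gamma Gamma' A A' :
  (forall D, Forall axiom D -> nd (Gamma ++ D) A -> nd (Gamma' ++ D) A') ->
  der Gamma A -> der Gamma' A'.
Proof. intros f (D & HD & H). exists D. auto. Qed.

(** Transfers a two-premise rule of [nd] to [der]: the axioms of the two premises are concatenated,
    and each premise is weakened to the common list. *)
Lemma der_nd2 Gamma Gamma1 Gamma2 A A1 A2 :
  (forall D, Forall axiom D -> nd (Gamma1 ++ D) A1 -> nd (Gamma2 ++ D) A2 ->
             nd (Gamma ++ D) A) ->
  der Gamma1 A1 -> der Gamma2 A2 -> der Gamma A.
Proof.
  intros f (D1 & HD1 & H1) (D2 & HD2 & H2).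
  exists (D1 ++ D2). split; [now apply Forall_app|].
  apply f; [now apply Forall_app | |].
  - apply nd_weaken with (1 := H1), incl_app_app; [apply incl_refl|].
    now apply incl_appl.
  - apply nd_weaken with (1 := H2), incl_app_app; [apply incl_refl|].
    now apply incl_appr.
Qed.

Lemma map_lift0_axioms Gamma D :
  Forall axiom D -> map lift0 (Gamma ++ D) = map lift0 Gamma ++ D.
Proof.
  intros HD. rewrite map_app. f_equal.
  induction HD as [|B D (_ & HB & _) _ IH]; simpl; congruence.
Qed.

Lemma map_lift1_axioms Gamma D :
  Forall axiom D -> map lift1 (Gamma ++ D) = map lift1 Gamma ++ D.
Proof.
  intros HD. rewrite map_app. f_equal.
  induction HD as [|B D (_ & _ & HB) _ IH]; simpl; congruence.
Qed.

Lemma der_hyp Gamma A : In A Gamma -> der Gamma A.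
Proof.
  intros H. exists []. split; [constructor|].
  apply nd_hyp, in_or_app. now left.
Qed.

Lemma der_botE Gamma A : der Gamma bot -> der Gamma A.
Proof. apply der_nd1. intros. now apply nd_botE. Qed.

Lemma der_andI Gamma A B : der Gamma A -> der Gamma B -> der Gamma (and A B).
Proof. apply der_nd2. intros. now apply nd_andI. Qed.

Lemma der_andE2 Gamma A B : der Gamma (and A B) -> der Gamma B.
Proof. apply der_nd1. intros. now apply nd_andE2 with A. Qed.

Lemma der_orI1 Gamma A B : der Gamma A -> der Gamma (or A B).
Proof. apply der_nd1. intros. now apply nd_orI1. Qed.

Lemma der_orI2 Gamma A B : der Gamma B -> der Gamma (or A B).
Proof. apply der_nd1. intros. now apply nd_orI2. Qed.

Lemma der_impI Gamma A B : der (A :: Gamma) B -> der Gamma (imp A B).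
Proof. apply der_nd1. intros. now apply nd_impI. Qed.

Lemma der_impE Gamma A B : der Gamma (imp A B) -> der Gamma A -> der Gamma B.
Proof. apply der_nd2. intros. now apply nd_impE with A. Qed.

Lemma der_orE Gamma A B C :
  der Gamma (or A B) -> der (A :: Gamma) C -> der (B :: Gamma) C -> der Gamma C.
Proof.
  intros H HA HB.
  (* Only two premises can be merged at once, so the third is packed into the implication B -> C,
     and (B -> C) -> C is derived from the other two. *)
  apply der_impI in HB. revert HB.
  apply der_impE. revert H HA. apply der_nd2. intros D _ H HA.
  apply nd_impI, nd_orE with A B.
  - apply nd_weaken with (1 := H), incl_tl, incl_refl.
  - apply nd_weaken with (1 := HA), incl_cons; [now left|].
    apply incl_tl, incl_tl, incl_refl.
  - apply nd_impE with B; apply nd_hyp; simpl; auto.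
Qed.

Lemma der_all0I Gamma A : der (map lift0 Gamma) A -> der Gamma (all0 A).
Proof.
  apply der_nd1. intros D HD H. apply nd_all0I. now rewrite map_lift0_axioms.
Qed.

Lemma der_all0E Gamma A t : der Gamma (all0 A) -> der Gamma (inst0 A t).
Proof. apply der_nd1. intros. now apply nd_all0E. Qed.

Lemma der_ex0I Gamma A t : der Gamma (inst0 A t) -> der Gamma (ex0 A).
Proof. apply der_nd1. intros. now apply nd_ex0I with t. Qed.

Lemma der_ex0E Gamma A B :
  der Gamma (ex0 A) -> der (A :: map lift0 Gamma) (lift0 B) -> der Gamma B.
Proof.
  apply der_nd2. intros D HD H1 H2. apply nd_ex0E with A; [exact H1|].
  now rewrite map_lift0_axioms.
Qed.

Lemma der_all1I Gamma A : der (map lift1 Gamma) A -> der Gamma (all1 A).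
Proof.
  apply der_nd1. intros D HD H. apply nd_all1I. now rewrite map_lift1_axioms.
Qed.

Lemma der_all1E Gamma A F : der Gamma (all1 A) -> der Gamma (inst1 A F).
Proof. apply der_nd1. intros. now apply nd_all1E. Qed.

Lemma der_ex1E Gamma A B :
  der Gamma (ex1 A) -> der (A :: map lift1 Gamma) (lift1 B) -> der Gamma B.
Proof.
  apply der_nd2. intros D HD H1 H2. apply nd_ex1E with A; [exact H1|].
  now rewrite map_lift1_axioms.
Qed.

(** * Equational reasoning *)

Definition teq (Gamma : list form) (t u : term) : Prop := der Gamma (eq0 t u).

(** Lets an arbitrary term serve as a parameter under a binder: instantiating the bound variable
    undoes the shift. *)
Lemma subst_term_wk0 u t : subst_term (scons u tvar) fvar (subst_term wk0 fvar t) = t.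
Proof.
  induction t as [i| |t1 IH1 t2 IH2|[j|c] t IH]; simpl; congruence.
Qed.

Lemma der_eq0E Gamma A t u : teq Gamma t u -> der Gamma (inst0 A t) -> der Gamma (inst0 A u).
Proof. apply der_nd2. intros. now apply nd_eq0E with t. Qed.

Lemma teq_refl Gamma t : teq Gamma t t.
Proof. exists []. split; [constructor|]. apply nd_eq0I. Qed.

Lemma teq_sym Gamma t u : teq Gamma t u -> teq Gamma u t.
Proof.
  intros H.
  (* Leibniz's rule for the formula x = t in the variable x, turning t = t into u = t. *)
  generalize (der_eq0E Gamma (eq0 (tvar 0) (subst_term wk0 fvar t)) _ _ H).
  unfold inst0; simpl. rewrite !subst_term_wk0. intros K. apply K, teq_refl.
Qed.

Lemma teq_trans Gamma t u v : teq Gamma t u -> teq Gamma u v -> teq Gamma t v.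
Proof.
  intros H1 H2.
  generalize (der_eq0E Gamma (eq0 (subst_term wk0 fvar t) (tvar 0)) _ _ H2).
  unfold inst0; simpl. rewrite !subst_term_wk0. intros K. apply K, H1.
Qed.

#[local] Instance teq_equivalence Gamma : Equivalence (teq Gamma).
Proof.
  split; [intro; apply teq_refl | intros ? ?; apply teq_sym
         | intros ? ? ?; apply teq_trans].
Qed.

#[local] Instance tapp_proper Gamma F : Proper (teq Gamma ==> teq Gamma) (tapp F).
Proof.
  intros t u H.
  generalize (der_eq0E Gamma (eq0 (tapp F (subst_term wk0 fvar t)) (tapp F (tvar 0))) _ _ H).
  unfold inst0; simpl. rewrite !subst_term_wk0.
  replace (subst_fterm fvar F) with F by now destruct F.
  intros K. apply K, teq_refl.
Qed.

#[local] Instance capp_proper Gamma c : Proper (teq Gamma ==> teq Gamma) (capp c).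
Proof. apply tapp_proper. Qed.

#[local] Instance tpair_proper Gamma :
  Proper (teq Gamma ==> teq Gamma ==> teq Gamma) tpair.
Proof.
  intros t u H t' u' H'. transitivity (tpair u t').
  - generalize (der_eq0E Gamma (eq0 (tpair (subst_term wk0 fvar t) (subst_term wk0 fvar t'))
                                (tpair (tvar 0) (subst_term wk0 fvar t'))) _ _ H).
    unfold inst0; simpl. rewrite !subst_term_wk0. intros K. apply K, teq_refl.
  - generalize (der_eq0E Gamma (eq0 (tpair (subst_term wk0 fvar u) (subst_term wk0 fvar t'))
                                (tpair (subst_term wk0 fvar u) (tvar 0))) _ _ H').
    unfold inst0; simpl. rewrite !subst_term_wk0. intros K. apply K, teq_refl.
Qed.

#[local] Instance capp2_proper Gamma c :
  Proper (teq Gamma ==> teq Gamma ==> teq Gamma) (capp2 c).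
Proof. intros t u H t' u' H'. unfold capp2. now rewrite H, H'. Qed.

#[local] Instance suc_proper Gamma : Proper (teq Gamma ==> teq Gamma) suc.
Proof. apply tapp_proper. Qed.

Ltac closed_axiom := apply der_axiom; split; [constructor | split; reflexivity].

Section Equations.
Variable Gamma : list form.

Lemma teq_Id t : teq Gamma (capp cId t) t.
Proof. apply (der_all0E _ (eq0 (capp cId (tvar 0)) (tvar 0)) t). closed_axiom. Qed.

Lemma teq_Zero t : teq Gamma (capp cZero t) tzero.
Proof. apply (der_all0E _ (eq0 (capp cZero (tvar 0)) tzero) t). closed_axiom. Qed.

Lemma teq_K t u : teq Gamma (capp cK (tpair t u)) t.
Proof.
  (* The axiom has two quantifiers. Instantiating the outer one leaves t shifted under the inner
     one, and the second instantiation cancels this shift. *)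
  generalize (der_all0E Gamma (eq0 (capp cK (tpair (subst_term wk0 fvar t) (tvar 0)))
                               (subst_term wk0 fvar t)) u).
  unfold inst0; simpl. rewrite subst_term_wk0. intros H. apply H.
  apply (der_all0E _ (all0 (eq0 (capp cK (tpair (tvar 1) (tvar 0))) (tvar 1))) t).
  closed_axiom.
Qed.

Lemma teq_L t u : teq Gamma (capp cL (tpair t u)) u.
Proof.
  generalize (der_all0E Gamma (eq0 (capp cL (tpair (subst_term wk0 fvar t) (tvar 0)))
                               (tvar 0)) u).
  unfold inst0; simpl. rewrite subst_term_wk0. intros H. apply H.
  apply (der_all0E _ (all0 (eq0 (capp cL (tpair (tvar 1) (tvar 0))) (tvar 0))) t).
  closed_axiom.
Qed.

Lemma teq_Comp f g t : teq Gamma (capp (cComp f g) t) (capp f (capp g t)).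
Proof.
  apply (der_all0E _ (eq0 (capp (cComp f g) (tvar 0)) (capp f (capp g (tvar 0)))) t).
  closed_axiom.
Qed.

Lemma teq_Pair f g t : teq Gamma (capp (cPair f g) t) (tpair (capp f t) (capp g t)).
Proof.
  apply (der_all0E _ (eq0 (capp (cPair f g) (tvar 0))
                          (tpair (capp f (tvar 0)) (capp g (tvar 0)))) t).
  closed_axiom.
Qed.

Lemma teq_Rec0 f g t : teq Gamma (capp (cRec f g) (tpair t tzero)) (capp f t).
Proof.
  apply (der_all0E _ (eq0 (capp2 (cRec f g) (tvar 0) tzero) (capp f (tvar 0))) t).
  closed_axiom.
Qed.

Lemma teq_RecS f g t u :
  teq Gamma (capp (cRec f g) (tpair t (capp cSuc u)))
            (capp g (tpair (tpair t u) (capp (cRec f g) (tpair t u)))).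
Proof.
  generalize (der_all0E Gamma (eq0 (capp2 (cRec f g) (subst_term wk0 fvar t) (suc (tvar 0)))
                         (app3 (fcst g) (subst_term wk0 fvar t) (tvar 0)
                               (capp2 (cRec f g) (subst_term wk0 fvar t) (tvar 0)))) u).
  unfold inst0; simpl. rewrite subst_term_wk0. intros H. apply H.
  apply (der_all0E _ (all0 (eq0 (capp2 (cRec f g) (tvar 1) (suc (tvar 0)))
                         (app3 (fcst g) (tvar 1) (tvar 0)
                               (capp2 (cRec f g) (tvar 1) (tvar 0))))) t).
  closed_axiom.
Qed.

Lemma suc_neq0 t : teq Gamma (suc t) tzero -> der Gamma bot.
Proof.
  apply der_impE.
  apply (der_all0E _ (neg (eq0 (suc (tvar 0)) tzero)) t).
  closed_axiom.
Qed.

Lemma suc_inj t u : teq Gamma (suc t) (suc u) -> teq Gamma t u.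
Proof.
  apply der_impE.
  generalize (der_all0E Gamma (imp (eq0 (suc (subst_term wk0 fvar t)) (suc (tvar 0)))
                             (eq0 (subst_term wk0 fvar t) (tvar 0))) u).
  unfold inst0; simpl. rewrite subst_term_wk0. intros H. apply H.
  apply (der_all0E _ (all0 (imp (eq0 (suc (tvar 1)) (suc (tvar 0)))
                                (eq0 (tvar 1) (tvar 0)))) t).
  closed_axiom.
Qed.

End Equations.

(** Everything is unfolded to [capp] and [tpair], the form in which the defining equations above are
    stated; rewriting with them then computes the value. *)
Ltac evaluate :=
  unfold cEntry, cLength, cIf, cIterL, cMonus, cPred, cPlus, capp2, app3, app2, suc; cbv zeta;
  repeat first
    [ rewrite teq_Id | rewrite teq_Zero | rewrite teq_K | rewrite teq_L
    | rewrite teq_Comp | rewrite teq_Pair | rewrite teq_Rec0 | rewrite teq_RecS ];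
  try reflexivity.

Lemma plus_0_r Gamma t : teq Gamma (capp2 cPlus t tzero) t.
Proof. evaluate. Qed.

Lemma plus_suc_r Gamma t u :
  teq Gamma (capp2 cPlus t (suc u)) (suc (capp2 cPlus t u)).
Proof. evaluate. Qed.

(** * Arithmetic *)

Lemma zero_or_suc Gamma t :
  der Gamma (or (eq0 t tzero) (ex0 (eq0 (subst_term wk0 fvar t) (suc (tvar 0))))).
Proof.
  pose (A := or (eq0 (tvar 0) tzero) (ex0 (eq0 (tvar 1) (suc (tvar 0))))).
  apply (der_all0E _ A t).
  apply der_impE with
    (and (inst0 A tzero) (all0 (imp A (subst (scons (suc (tvar 0)) wk0) fvar A)))).
  (* Variable 0 is the only free variable of [A], so the closure in its induction axiom adds no
     quantifier. *)
  - apply der_axiom. split; [apply (BIM_induction A) | split; reflexivity].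
  - apply der_andI.
    + apply der_orI1, teq_refl.
    + apply der_all0I, der_impI, der_orI2, der_ex0I with (tvar 0), teq_refl.
Qed.

(** The contexts are abstract so that equations can be rewritten without touching
    the hypotheses. *)
Lemma der_case Gamma t A C :
  (forall G, teq G t tzero -> der G A -> der G C) ->
  (forall G, teq G (subst_term wk0 fvar t) (suc (tvar 0)) ->
             der G (lift0 A) -> der G (lift0 C)) ->
  der Gamma A -> der Gamma C.
Proof.
  intros H0 HS. apply der_impE.
  apply der_orE with (1 := zero_or_suc Gamma t).
  - apply der_impI, H0; apply der_hyp; simpl; auto.
  - eapply der_ex0E; [apply der_hyp; left; reflexivity|].
    apply der_impI, HS; apply der_hyp; simpl; auto.
Qed.

(** Addition recurses on its second argument, so u is split: the sum is S(t) if u = 0, and S(S(t) +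
    v) if u = S(v). *)
Lemma plus_suc_l_neq0 Gamma t u :
  teq Gamma (capp2 cPlus (suc t) u) tzero -> der Gamma bot.
Proof.
  apply (der_case Gamma u (eq0 (capp2 cPlus (suc t) u) tzero)); intros G Hu H.
  - apply (suc_neq0 G t).
    transitivity (capp2 cPlus (suc t) u); [|exact H].
    now rewrite Hu, plus_0_r.
  - apply (suc_neq0 G (capp2 cPlus (suc (subst_term wk0 fvar t)) (tvar 0))).
    transitivity (capp2 cPlus (suc (subst_term wk0 fvar t)) (subst_term wk0 fvar u));
      [|exact H].
    now rewrite Hu, plus_suc_r.
Qed.

(** If u = 0, the equation is S(S(t)) = 2. If u = S(v), cancelling two successors leaves S(t) + v =
    0, which is absurd. *)
Lemma plus_suc_suc_2 Gamma t u :
  teq Gamma (capp2 cPlus (suc t) (suc u)) (num 2) -> teq Gamma t tzero.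
Proof.
  apply (der_case Gamma u (eq0 (capp2 cPlus (suc t) (suc u)) (num 2)) (eq0 t tzero));
    intros G Hu H.
  - apply suc_inj, suc_inj.
    transitivity (capp2 cPlus (suc t) (suc u)); [|exact H].
    now rewrite plus_suc_r, Hu, plus_0_r.
  - apply der_botE, (plus_suc_l_neq0 G (subst_term wk0 fvar t) (tvar 0)).
    apply suc_inj, suc_inj.
    transitivity (capp2 cPlus (suc (subst_term wk0 fvar t))
                              (suc (subst_term wk0 fvar u))); [|exact H].
    now rewrite Hu, !plus_suc_r.
Qed.

(** In [incr_seq 2] the entries i and i+1 are compared when S(i) < 2; this reduces the comparison to
    i = 0. *)
Lemma suc_lt_2 Gamma t :
  der Gamma (lt (suc t) (num 2)) -> teq Gamma t tzero.
Proof.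
  intros H. eapply der_ex0E; [exact H|].
  apply plus_suc_suc_2 with (tvar 0), der_hyp. now left.
Qed.

Lemma incr_seq_01 Gamma : der Gamma (incr_seq 2 (code [tzero; num 1])).
Proof.
  apply der_andI.
  - change (teq Gamma (capp cLength (code [tzero; num 1])) (num 2)).
    unfold code, tuple, num; simpl Nat.iter. evaluate.
  - apply der_all0I, der_impI.
    set (G := _ :: _).
    assert (H0 : teq G (tvar 0) tzero) by (apply suc_lt_2, der_hyp; now left).
    (* The entries are 0 and 1, and 0 + S(0) = 1, so the difference witness p in [lt] is 0. *)
    apply der_ex0I with tzero.
    change (teq G (capp2 cPlus (capp2 cEntry (code [tzero; num 1]) (tvar 0)) (suc tzero))
                  (capp2 cEntry (code [tzero; num 1]) (suc (tvar 0)))).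
    rewrite H0. clearbody G. clear H0.
    unfold code, tuple, num; simpl Nat.iter. evaluate.
Qed.

(** * From homogeneous sets to LPO *)

Definition has_nonzero : form := ex0 (neg (eq0 (tapp (fvar 0) (tvar 0)) tzero)).

(** The equations on [R] say that [R] has no free number variables. *)
Lemma homogeneous_elim Gamma R :
  (forall sigma, subst sigma wk1 R = lift1 R) ->
  (forall sigma, subst sigma fvar (lift1 R) = lift1 R) ->
  der Gamma (homogeneous 2 R) -> der Gamma R.
Proof.
  intros HR HR' H. eapply der_ex1E; [exact H|]. rewrite HR.
  (* [lift1 R] is rewritten as its own instance at the code of <0,1>, so that it matches the result
     of instantiating s. *)
  set (G := _ :: _). rewrite <- (HR' (scons (code [tzero; num 1]) tvar)).
  apply der_impE with (incr_seq 2 (code [tzero; num 1])); [|apply incr_seq_01].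
  apply (der_all0E G (imp (incr_seq 2 (tvar 0)) (lift1 R))).
  eapply der_andE2, der_hyp. now left.
Qed.

Lemma not_has_nonzero Gamma :
  der Gamma (neg has_nonzero) -> der Gamma (all0 (eq0 (tapp (fvar 0) (tvar 0)) tzero)).
Proof.
  apply der_impE, der_impI, der_all0I.
  apply der_case with (tapp (fvar 0) (tvar 0)) (lift0 (neg has_nonzero)).
  - auto.
  - intros G Hsuc Hneg. apply der_botE, (der_impE _ _ _ Hneg).
    (* Here variable 0 is the predecessor m with alpha(n) = S(m), and n has been shifted to variable
       1. *)
    apply der_ex0I with (tvar 1), der_impI.
    apply suc_neq0 with (tvar 0).
    apply teq_trans with (tapp (fvar 0) (tvar 1)); [|apply der_hyp; now left].
    apply teq_sym, der_weaken with (1 := Hsuc), incl_tl, incl_refl.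
  - apply der_hyp. now left.
Qed.

Theorem theorem10p1 : proves_scheme_imp BIM Star LPO.
Proof.
  exists [closure (or (homogeneous 2 has_nonzero) (homogeneous 2 (neg has_nonzero)))].
  split.
  - intros B [<- | []]. apply Star_instance.
  - apply der_proves, der_impI, der_all1I.
    apply der_orE with (homogeneous 2 has_nonzero) (homogeneous 2 (neg has_nonzero)).
    (* The closure of this instance is a single function quantifier, binding alpha; it is
       instantiated with the alpha of LPO. *)
    + apply (der_all1E _ (or (homogeneous 2 has_nonzero)
                             (homogeneous 2 (neg has_nonzero))) (fvar 0)).
      apply der_hyp. now left.
    (* Both conditions on R hold by computation, since alpha is its only free variable. *)
    + apply der_orI1, homogeneous_elim; try reflexivity.
      apply der_hyp. now left.
    + apply der_orI2, not_has_nonzero, homogeneous_elim; try reflexivity.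
      apply der_hyp. now left.
Qed.
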